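(* Assume $k>1$. Then (1) $b=(r+1)\sum_{i=1}^{k-1}(l_i+1)-(p+1)(e-r-1)+h=X+Y+Z$, where $X=(k-1)(r-1)\ge0$, $Y=k-(e-r)\ge0$, and $Z=(r+1)(p+\sum_{i=1}^{k-1}l_i)+k+h-pe-1\ge\sum_{i\in A}(r-r_i)\ge0$; (2) $c=\bigl(p+1+\sum_{i=1}^{k-1}(l_i+1)\bigr)(r+1)-b$.
   Context: Let $(R,\mathfrak m)$ be a one-dimensional local Noetherian domain with quotient field $K$, not regular, analytically irreducible (the integral closure $\overline R$ of $R$ in $K$ is a DVR and a finite $R$-module) and residually rational. Let $v$ be the valuation of $\overline R$ normalized so a uniformizer $t$ has value 1, $v(R)=\{v(a):a\in R\setminus\{0\}\}$, $\mathfrak C=(R:_K\overline R)=t^c\overline R$ with $c$ the least element of $v(R)$ with $c+\mathbb N\subseteq v(R)$, $\delta=\ell_R(\overline R/R)$, $r=\ell_R((R:_K\mathfrak m)/R)$, $b=(c-\delta)r-\delta$, $e$ the least positive element of $v(R)$, $n=c-\delta$. Write $v(R)=\{s_0=0<s_1<\cdots\}$ ($s_n=c$), $R_i=\{a\in R:v(a)\ge s_i\}$, $r_i=\ell_R((R:_KR_i)/(R:_KR_{i-1}))$. Let $i_0\in[1,n]$ be such that $s_{i_0-1}=\min\{y\in v(R):y\ge c-e\}$, $B=\{i_0,\dots,n\}$, $A=\{1,\dots,n\}\setminus B$. Let $x\in\mathfrak m$ with $v(x)=e$ and $k=\ell_R(R/(\mathfrak C+xR))$. When $k>1$: $p$ is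 the integer with $c-e\le pe<c$, $h=(p+1)e-c$; $y_1<\dots<y_{k-1}$ are the nonzero elements of $v(R)\setminus v(\mathfrak C+xR)$ (equivalently, the $y\in v(R)$ with $0<y<c$ and $y-e\notin v(R)$; they are not multiples of $e$, exceed $e$, and have distinct residues mod $e$); $l_i\ge0$ is the integer with $y_i+l_ie<c\le y_i+(l_i+1)e$. Then $v(R)$ is the disjoint union of $\{0,e,\dots,pe\}$, $\{m\ge c\}$ and the sets $\{y_i,y_i+e,\dots,y_i+l_ie\}$. *)

(* Defs.v *)
(* A one-dimensional local domain R is modelled as a
   subring (a Prop-predicate) of a field K, with a normalized discrete
   valuation v : K -> int (values on nonzero elements only). *)
From mathcomp Require Import all_boot all_order all_algebra.
Set Implicit Arguments. Unset Strict Implicit. Unset Printing Implicit Defensive.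
Import Order.TTheory GRing.Theory Num.Theory.
Local Open Scope ring_scope.

Section Defs.
Variable K : fieldType.

Definition subsetK (A B : K -> Prop) := forall x, A x -> B x.

Definition subring (R : K -> Prop) :=
  [/\ R 0, R 1, (forall a b, R a -> R b -> R (a - b))
   & (forall a b, R a -> R b -> R (a * b))].

Definition submod (R M : K -> Prop) :=
  [/\ M 0, (forall a b, M a -> M b -> M (a + b))
   & (forall a m, R a -> M m -> M (a * m))].

Definition quotient_field_of (R : K -> Prop) :=
  forall x, exists a b, [/\ R a, R b, b != 0 & x = a / b].

Definition integral_over (R : K -> Prop) (x : K) :=
  exists q : {poly K}, [/\ q \is monic, (forall i, R q`_i) & root q x].

Definition integral_closure (R : K -> Prop) : K -> Prop := integral_over R.

Definition fin_gen (R M : K -> Prop) :=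
  exists g : seq K, (forall i, (i < size g)%N -> M g`_i) /\
    forall x, M x -> exists cs : seq K,
      (forall i, R cs`_i) /\ x = \sum_(i < size g) cs`_i * g`_i.

Definition noetherian (R : K -> Prop) :=
  forall I, submod R I -> subsetK I R -> fin_gen R I.

Definition unitR (R : K -> Prop) (a : K) := R a /\ a != 0 /\ R a^-1.

Definition maxideal (R : K -> Prop) : K -> Prop := fun a => R a /\ ~ unitR R a.

Definition local (R : K -> Prop) := submod R (maxideal R) /\ ~ maxideal R 1.

Definition prime_ideal (R P : K -> Prop) :=
  [/\ submod R P, subsetK P R, ~ P 1
   & forall a b, R a -> R b -> P (a * b) -> P a \/ P b].

Definition dim_one (R : K -> Prop) :=
  (exists P, prime_ideal R P /\ exists a, P a /\ a != 0) /\
  (forall P Q, prime_ideal R P -> prime_ideal R Q ->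
     (exists a, P a /\ a != 0) -> subsetK P Q -> subsetK Q P).

(* regular (dimension one): the maximal ideal is principal *)
Definition regular (R : K -> Prop) :=
  exists a, R a /\ forall z, maxideal R z <-> exists t, R t /\ z = t * a.

(* normalized discrete valuation of K (v 0 is irrelevant) *)
Definition discrete_valuation (v : K -> int) :=
  [/\ (forall x y, x != 0 -> y != 0 -> v (x * y) = v x + v y),
      (forall x y, x != 0 -> y != 0 -> x + y != 0 ->
                   Num.min (v x) (v y) <= v (x + y))
    & (forall z : int, exists x, x != 0 /\ v x = z)].

Definition val_ring (v : K -> int) : K -> Prop := fun x => x = 0 \/ 0 <= v x.

(* residually rational: R/m = Rbar / t Rbar *)
Definition residually_rational (R : K -> Prop) (v : K -> int) :=
  forall x, integral_closure R x -> exists a, R a /\ (x - a = 0 \/ 0 < v (x - a)).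

Definition strict_chain (R N M : K -> Prop) (n : nat) (ch : nat -> K -> Prop) :=
  [/\ (forall x, ch 0%N x <-> N x), (forall x, ch n x <-> M x),
      (forall i, (i <= n)%N -> submod R (ch i))
    & (forall i, (i < n)%N -> subsetK (ch i) (ch i.+1) /\
                              exists x, ch i.+1 x /\ ~ ch i x)].

(* length_is R M N l : the R-module M/N (N a submodule of M) has length l *)
Definition length_is (R M N : K -> Prop) (l : nat) :=
  (exists ch, strict_chain R N M l ch) /\
  (forall m ch, strict_chain R N M m ch -> (m <= l)%N).

Definition colon (R I : K -> Prop) : K -> Prop := fun x => forall a, I a -> R (x * a).

Definition vset (v : K -> int) (M : K -> Prop) : nat -> Prop :=
  fun t => exists a, [/\ M a, a != 0 & v a = t%:Z].

Definition Rfilt (R : K -> Prop) (v : K -> int) (s : nat -> nat) (i : nat) : K -> Prop :=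
  fun a => R a /\ (a = 0 \/ (s i)%:Z <= v a).

Definition condxR (R : K -> Prop) (x : K) : K -> Prop :=
  fun z => exists y a, [/\ colon R (integral_closure R) y, R a & z = y + x * a].

End Defs.

(* Main.v *)
(* Residual rationality makes the length of M/N, for R-modules between the
   conductor and the integral closure, equal to the number of values below [c]
   taken on M but not on N.  Hence [n] is the number of elements of v(R) below
   [c], and [k] the number of those in [c - e, c).  Sorting v(R) below [c] into
   progressions of step [e] gives n = p + 1 + sum (l_i + 1), which settles the
   identities.  The inequalities come from bounding [r] below by chains in
   (R : m) / R: the elements of value at least c - e give r >= e - k and r >= 1,
   and (R : R_i) / (R : R_(i-1)) embeds by multiplication by an element of value
   s_(i-1).  Finally (R : R_(i0-1)) contains R and all elements of value at
   least [e], so the r_i with i in A sum to at least c - n - (e - 1). *)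
Require Import Defs.
From mathcomp Require Import all_boot all_order all_algebra.
From mathcomp Require Import boolp zify ring.
Import Order.TTheory GRing.Theory Num.Theory.
Local Open Scope ring_scope.

(** * Counting the elements of a set of naturals below a bound *)

Section Counting.
Local Open Scope nat_scope.

Definition cnt (P : pred nat) (m : nat) : nat := \sum_(0 <= i < m) P i.

Lemma cntS P m : cnt P m.+1 = cnt P m + P m.
Proof. by rewrite /cnt big_nat_recr. Qed.

Lemma cnt0 P : cnt P 0 = 0.
Proof. by rewrite /cnt big_geq. Qed.

Lemma leq_cnt (P Q : pred nat) m :
  (forall t, t < m -> P t -> Q t) -> cnt P m <= cnt Q m.
Proof.
elim: m => [|m IH] h; first by rewrite !cnt0.
rewrite !cntS; apply: leq_add; first by apply: IH => t tm; apply: h; lia.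
by case: (P m) (h m) => [->|].
Qed.

Lemma eq_cnt (P Q : pred nat) m :
  (forall t, t < m -> P t = Q t) -> cnt P m = cnt Q m.
Proof. by move=> h; apply: eq_big_nat => t /h ->. Qed.

Lemma cnt_predT m : cnt predT m = m.
Proof. by elim: m => [|m IH]; rewrite ?cnt0 // cntS IH addn1. Qed.

Lemma cnt_pred1 t m : cnt (pred1 t) m = (t < m).
Proof.
elim: m => [|m IH]; first by rewrite cnt0.
by rewrite cntS IH /=; case: (ltngtP t m); lia.
Qed.

Lemma cnt_predU1 (P : pred nat) t m :
  t < m -> ~~ P t -> cnt (fun i => (i == t) || P i) m = (cnt P m).+1.
Proof.
move=> tm Pt; rewrite -add1n -[1]/(true : nat) -tm -cnt_pred1 -big_split.
apply: eq_big_nat => i _ /=.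
by case: eqVneq => [->|]; rewrite ?(negbTE Pt).
Qed.

Lemma ltn_cnt (P Q : pred nat) t m :
  (forall i, i < m -> P i -> Q i) -> t < m -> Q t -> ~~ P t ->
  cnt P m < cnt Q m.
Proof.
move=> h tm Qt Pt; rewrite -(cnt_predU1 _ _ _ tm Pt).
by apply: leq_cnt => i im /orP[/eqP->|/h->].
Qed.

Lemma cnt_shift (S : pred nat) e m : cnt (fun t => (e <= t) && S (t - e)) m = cnt S (m - e).
Proof.
elim: m => [|m IH]; first by rewrite sub0n !cnt0.
rewrite cntS IH; case: (leqP e m) => em /=; first by rewrite subSn // cntS.
by rewrite addn0; congr cnt; lia.
Qed.

Lemma cnt_gap (S : pred nat) a b :
  a <= b -> (forall t, a <= t < b -> ~~ S t) -> cnt S b = cnt S a.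
Proof.
move=> ab h; rewrite /cnt (big_cat_nat _ (n := a)) //= [X in _ + X]big1_seq ?addn0 //.
by move=> t /=; rewrite mem_index_iota => /h/negbTE->.
Qed.

Lemma cnt_full (S : pred nat) a b :
  a <= b -> (forall t, a <= t < b -> S t) -> cnt S b = cnt S a + (b - a).
Proof.
move=> ab h; rewrite /cnt (big_cat_nat _ (n := a)) //=; congr addn.
by rewrite -[RHS]muln1 -sum_nat_const_nat; apply: eq_big_nat => t /h ->.
Qed.

(** Strict growth of [s] leaves no element of [S] strictly between [s j] and [s j.+1], so the index
    of a value counts the smaller values. *)
Lemma cnt_enum (S : pred nat) (s : nat -> nat) :
  s 0 = 0 -> (forall i, s i < s i.+1) -> (forall t, S t <-> exists i, s i = t) ->
  forall j, cnt S (s j) = j.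
Proof.
move=> s0 sS hS.
have smono : {mono s : i j / i < j}.
  by apply/leqW_mono/leq_mono; apply: homo_ltn sS; apply: ltn_trans.
elim=> [|j IH]; first by rewrite s0 cnt0.
have -> : cnt S (s j.+1) = cnt S (s j).+1.
  apply: cnt_gap => // t /andP[t1 t2]; apply/negP => /hS[i it].
  by move: t1 t2; rewrite -it !smono; lia.
by rewrite cntS IH (introT idP (proj2 (hS _) (ex_intro _ j erefl))) addn1.
Qed.

(** * Apery sets and progressions of step [e] *)

Section Apery.
Variables (S : pred nat) (e : nat).
Hypothesis e_gt0 : 0 < e.
Hypothesis S_add : forall t, S t -> S (t + e).

(** The Apery set of [S]: the first terms of its progressions of step [e]. The test [e <= t] guards
    against truncated subtraction. *)
Definition apery : pred nat := fun t => S t && ~~ ((e <= t) && S (t - e)).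

Lemma cnt_apery m : cnt S m = cnt S (m - e) + cnt apery m.
Proof.
elim: m => [|m IH]; first by rewrite sub0n !cnt0.
rewrite !cntS IH /apery; case: (leqP e m) => em.
  rewrite subSn // cntS /=.
  have := S_add (m - e); rewrite subnK //.
  by case: (S (m - e)) => [->//|_]; [lia|rewrite /= andbT; lia].
have -> : m.+1 - e = m - e by lia.
by rewrite /= andbT; lia.
Qed.

Lemma cnt_apery_iter m J :
  cnt S m = cnt S (m - J * e) + \sum_(0 <= j < J) cnt apery (m - j * e).
Proof.
elim: J => [|J IH]; first by rewrite big_geq // mul0n subn0 addn0.
rewrite big_nat_recr //= {1}IH cnt_apery.
have -> : m - J * e - e = m - J.+1 * e by lia.
lia.
Qed.

Lemma cnt_sum_apery m :
  cnt S m = \sum_(0 <= w < m | apery w) \sum_(0 <= j < m) (w + j * e < m).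
Proof.
rewrite (cnt_apery_iter m m).
(* As [e] is positive, [m] shifts exhaust everything below [m]; exchanging the two sums then groups
   the count by progression. *)
have -> : m - m * e = 0 by nia.
rewrite cnt0 add0n exchange_big /=; apply: eq_bigr => j _.
rewrite /cnt (big_cat_nat _ (n := m - j * e) (m := 0) (p := m)) //=; last lia.
rewrite [X in _ = _ + X]big1_seq ?addn0; last first.
  by move=> w /= /andP[_]; rewrite mem_index_iota => /andP[w1 w2]; apply/eqP; lia.
rewrite [RHS]big_mkcond; apply: eq_big_nat => w /andP[_ wm].
by case: (apery w) => //; lia.
Qed.

Lemma progression_count w l m :
  w + l * e < m -> m <= w + l.+1 * e -> \sum_(0 <= j < m) (w + j * e < m) = l.+1.
Proof.
move=> h1 h2; have lm : l.+1 <= m by nia.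
rewrite -[RHS]cnt_predT /cnt (big_cat_nat _ (n := l.+1)) //=.
rewrite [X in _ + X]big1_seq ?addn0; last first.
  by move=> j /=; rewrite mem_index_iota => /andP[j1 j2]; apply/eqP; nia.
by apply: eq_big_nat => j /andP[_ jl]; nia.
Qed.

End Apery.

End Counting.

(** * Discrete valuations and their fractional ideals *)

Section Valuation.
Variables (K : fieldType) (v : K -> int).
Hypothesis hv : discrete_valuation v.

(** The fractional ideals of the valuation ring; zero is listed apart because [v 0] is arbitrary. *)
Definition vge (t : int) (a : K) : Prop := a = 0 \/ t <= v a.

Lemma dvalM a b : a != 0 -> b != 0 -> v (a * b) = v a + v b.
Proof. by case: hv => h _ _; apply: h. Qed.

Lemma dval1 : v 1 = 0.
Proof. by have := dvalM 1 1 (oner_neq0 _) (oner_neq0 _); rewrite mulr1; lia. Qed.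

Lemma dvalV a : a != 0 -> v a^-1 = - v a.
Proof.
move=> a0; have := dvalM a a^-1 a0; rewrite invr_eq0 divff // dval1 => /(_ a0); lia.
Qed.

Lemma dvalN a : v (- a) = v a.
Proof.
have [->|a0] := eqVneq a 0; first by rewrite oppr0.
have m10 : (-1 : K) != 0 by rewrite oppr_eq0 oner_neq0.
have := dvalM (-1) (-1) m10 m10; rewrite mulrNN mulr1 dval1 => h.
by rewrite -mulN1r dvalM //; lia.
Qed.

Lemma vgeW t u a : t <= u -> vge u a -> vge t a.
Proof. by move=> tu [->|h]; [left|right; lia]. Qed.

Lemma vge_neq0 t a : a != 0 -> vge t a -> t <= v a.
Proof. by move=> a0 [h|//]; rewrite h eqxx in a0. Qed.

Lemma vgeD t a b : vge t a -> vge t b -> vge t (a + b).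
Proof.
move=> [->|ha]; first by rewrite add0r.
move=> [->|hb]; first by rewrite addr0; right.
have [->|a0] := eqVneq a 0; first by rewrite add0r; right.
have [->|b0] := eqVneq b 0; first by rewrite addr0; right.
have [ab0|ab0] := eqVneq (a + b) 0; first by left.
by right; case: hv => _ h _; apply: le_trans (h _ _ a0 b0 ab0); rewrite le_min ha hb.
Qed.

Lemma vgeN t a : vge t a -> vge t (- a).
Proof. by move=> [->|h]; [left; rewrite oppr0|right; rewrite dvalN]. Qed.

Lemma vgeB t a b : vge t a -> vge t b -> vge t (a - b).
Proof. by move=> ha /vgeN; apply: vgeD. Qed.

Lemma vgeM t u a b : vge t a -> vge u b -> vge (t + u) (a * b).
Proof.
have [->|a0] := eqVneq a 0; first by rewrite mul0r; left.
have [->|b0] := eqVneq b 0; first by rewrite mulr0; left.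
by move=> /(vge_neq0 _ _ a0) ha /(vge_neq0 _ _ b0) hb; right; rewrite dvalM //; lia.
Qed.

Lemma val_vge a : vge (v a) a.
Proof. by right. Qed.

Lemma vgeV a : vge (- v a) a^-1.
Proof.
have [->|a0] := eqVneq a 0; first by left; rewrite invr0.
by right; rewrite dvalV.
Qed.

(** Were the sum zero or of larger value, then [a], the difference of the sum and [b], would have
    value above [v a]. *)
Lemma dvalD_lt a b : a != 0 -> vge (v a + 1) b -> a + b != 0 /\ v (a + b) = v a.
Proof.
move=> a0 hb; have ab0 : a + b != 0.
  apply/negP => /eqP/(canRL (addKr _)); rewrite addr0 => bE.
  by move: hb; rewrite bE => /vge_neq0; rewrite oppr_eq0 dvalN => /(_ a0); lia.
split=> //.
have h1 : vge (v a) (a + b) by apply: vgeD (val_vge _) (vgeW _ _ _ _ hb); lia.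
have {}h1 := vge_neq0 _ _ ab0 h1.
have [//|ne] := eqVneq (v (a + b)) (v a).
have : vge (v a + 1) (a + b - b) by apply: vgeB hb; right; lia.
by rewrite addrK => /(vge_neq0 _ _ a0); lia.
Qed.

Lemma exists_val (t : int) : exists a, a != 0 /\ v a = t.
Proof. by case: hv. Qed.

End Valuation.

Arguments vge {K} v t a.

(** * Modules over a subring and chains of them *)

Section Submodules.
Variables (K : fieldType) (R : K -> Prop).
Hypothesis hR : subring R.

Lemma subring_submod : submod R R.
Proof.
case: hR => R0 R1 RB RM; split=> // a b Ra Rb.
by rewrite -[b]opprK -[- b]sub0r; apply: (RB) => //; apply: RB.
Qed.

Lemma submodN M a : submod R M -> M a -> M (- a).
Proof.
case: hR => R0 R1 RB _ [_ _ MZ] Ma.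
by rewrite -mulN1r; apply: MZ => //; rewrite -sub0r; apply: RB.
Qed.

Lemma submodB M a b : submod R M -> M a -> M b -> M (a - b).
Proof. by move=> sM Ma Mb; case: (sM) => _ MD _; apply: MD => //; apply: submodN. Qed.

Lemma submod_sum M I (s : seq I) (P : pred I) (F : I -> K) :
  submod R M -> (forall i, P i -> M (F i)) -> M (\sum_(i <- s | P i) F i).
Proof. by case=> M0 MD _ h; elim/big_ind: _. Qed.

Lemma colon_submod I : submod R (colon R I).
Proof.
case: subring_submod => R0 RD RM; split=> [a _|a b ha hb w Iw|a m Ra hm w Iw].
- by rewrite mul0r.
- by rewrite mulrDl; apply: RD; [apply: ha|apply: hb].
- by rewrite -mulrA; apply: RM => //; apply: hm.
Qed.

Definition addmod (A B : K -> Prop) : K -> Prop :=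
  fun z => exists a b, [/\ A a, B b & z = a + b].

Lemma addmod_submod A B : submod R A -> submod R B -> submod R (addmod A B).
Proof.
move=> [A0 AD AM] [B0 BD BM]; split.
- by exists 0, 0; split; rewrite ?addr0.
- move=> _ _ [a [b [Aa Bb ->]]] [a' [b' [Aa' Bb' ->]]].
  by exists (a + a'), (b + b'); split; [apply: AD|apply: BD|rewrite addrACA].
- move=> u _ Ru [a [b [Aa Bb ->]]].
  by exists (u * a), (u * b); split; [apply: AM|apply: BM|rewrite mulrDr].
Qed.

Lemma addmod_l (A B : K -> Prop) z : submod R B -> A z -> addmod A B z.
Proof. by case=> B0 _ _ Az; exists z, 0; split; rewrite ?addr0. Qed.

Lemma addmod_r (A B : K -> Prop) z : submod R A -> B z -> addmod A B z.
Proof. by case=> A0 _ _ Az; exists 0, z; split; rewrite ?add0r. Qed.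

Definition scalemod (x : K) (A : K -> Prop) : K -> Prop :=
  fun z => exists2 a, A a & z = x * a.

Lemma scalemod_submod x A : submod R A -> submod R (scalemod x A).
Proof.
move=> [A0 AD AM]; split.
- by exists 0; rewrite ?mulr0.
- by move=> _ _ [a Aa ->] [b Ab ->]; exists (a + b); [apply: AD|rewrite mulrDr].
- by move=> u _ Ru [a Aa ->]; exists (u * a); [apply: AM|rewrite mulrCA].
Qed.

Lemma strict_chain_sub N M n ch i j :
  strict_chain R N M n ch -> (i <= j <= n)%N -> subsetK (ch i) (ch j).
Proof.
case=> _ _ _ h; elim: j => [|j IH]; first by rewrite leqn0 => /andP[/eqP-> _] x.
case/andP; rewrite leq_eqVlt => /orP[/eqP-> _ x //|ij jn] x /IH hx.
by case: (h j jn) => hj _; apply/hj/hx; lia.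
Qed.

(** Allows a chain ending inside [M'] to be bounded by a length taken at [M']: append [M'] if it is
    strictly larger, otherwise the chain already ends there. *)
Lemma strict_chain_extend N M M' n ch :
  strict_chain R N M n ch -> submod R M' -> subsetK M M' ->
  exists m ch', (n <= m)%N /\ strict_chain R N M' m ch'.
Proof.
move=> hch sM' MM'; have [M'M|nM'M] := pselect (subsetK M' M).
  exists n, ch; split=> //; case: hch => h0 hn hs hst; split=> // x.
  by rewrite hn; split; [apply: MM'|apply: M'M].
have /existsNP[w /not_implyP[M'w nMw]] := nM'M.
case: hch => h0 hn hs hst.
exists n.+1, (fun i => if (i <= n)%N then ch i else M'); split=> //; split.
- by rewrite leq0n.
- by rewrite ltnn.
- by move=> i _; case: ifP => // /hs.
move=> i; rewrite ltnS => ile; rewrite ile; case: ifP => [/hst//|/negbT].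
rewrite -leqNgt => nle; have {nle ile}-> : i = n by lia.
by split=> [x /hn/MM'//|]; exists w; split=> // /hn.
Qed.

Lemma strict_chain_cons N N' M n ch :
  submod R N -> subsetK N N' -> (exists w, N' w /\ ~ N w) ->
  strict_chain R N' M n ch ->
  strict_chain R N M n.+1 (fun i => if i is i'.+1 then ch i' else N).
Proof.
move=> sN NN' [w [N'w nNw]] [h0 hn hs hst]; split=> //.
- by case=> [|i] //; apply: hs.
- case=> [|i] hi; last exact: hst.
  by split=> [x /NN'/h0//|]; exists w; split=> //; apply/h0.
Qed.

End Submodules.

Arguments addmod {K} A B z.
Arguments scalemod {K} x A z.

(** * Comparing modules through their values *)

Section Values.
Variables (K : fieldType) (R : K -> Prop) (v : K -> int).
Hypothesis hR : subring R.
Hypothesis hv : discrete_valuation v.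
Hypothesis hRbar : forall z, integral_closure R z <-> val_ring v z.
Hypothesis hres : residually_rational R v.

Lemma subring_vge0 a : R a -> vge v 0 a.
Proof.
case: hR => R0 R1 RB _ Ra; apply/hRbar; exists ('X - a%:P); split.
- exact: monicXsubC.
- by move=> i; rewrite coefB coefX coefC; case: i => [|[|i]] /=; apply: RB.
- by rewrite root_XsubC.
Qed.

Lemma vge_submod t : submod R (vge v t).
Proof.
split; first by left.
- by move=> a b; apply: vgeD.
- by move=> a b /subring_vge0 ha hb; rewrite -[t]add0r; apply: vgeM.
Qed.

Lemma vge_residue z : vge v 0 z -> exists a, R a /\ vge v 1 (z - a).
Proof.
by move=> /hRbar/hres[a [Ra h]]; exists a.
Qed.

(* [a^-1] lies in the integral closure; multiplying its integral equation by
   [a ^+ (d - 1)] expresses it as a polynomial in [a]. *)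
Lemma val0_inv a : R a -> a != 0 -> v a = 0 -> R a^-1.
Proof.
move=> Ra a0 va; have [q [qm qR]] : integral_over R a^-1.
  by apply/hRbar; right; rewrite dvalV // va oppr0.
have [_ RD RM] := subring_submod _ _ hR; case: (hR) => R0 R1 _ _.
have RX i : R (a ^+ i) by elim: i => [|i IH]; rewrite ?expr0 // exprS; apply: RM.
have := monic_neq0 qm; rewrite -size_poly_eq0.
case sq: (size q) => [//|d] _.
have qd : q`_d = 1 by move/monicP: qm; rewrite lead_coefE sq.
rewrite rootE horner_coef sq big_ord_recr /= qd mul1r addrC addr_eq0 => /eqP e.
case: d sq qd e => [|d] _ _.
  by rewrite expr0 big_ord0 oppr0 => /eqP; rewrite oner_eq0.
move/(congr1 (fun z => z * a ^+ d)).
rewrite exprSr mulrAC -exprMn mulVf // expr1n mul1r mulNr mulr_suml => ->.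
apply: (submodN _ _ hR) (subring_submod _ _ hR) _.
apply: submod_sum (subring_submod _ _ hR) _ => i _.
rewrite -mulrA; apply: RM => //.
have -> : a ^+ d = a ^+ i * a ^+ (d - i) by rewrite -exprD subnKC // -ltnS.
by rewrite mulrA -exprMn mulVf // expr1n mul1r.
Qed.

Lemma maxideal_val_gt0 a : maxideal R a -> vge v 1 a.
Proof.
case=> Ra nua; have [->|a0] := eqVneq a 0; first by left.
have := vge_neq0 _ _ _ _ a0 (subring_vge0 _ Ra) => va; right.
have [va0|] := eqVneq (v a) 0; last lia.
by case: nua; split=> //; split=> //; apply: val0_inv.
Qed.

(** [z / a] has value 0, and residual rationality supplies an element [u] of [R] with the same
    residue. *)
Lemma approx a z : a != 0 -> z != 0 -> v a = v z ->
  exists u, R u /\ vge v (v z + 1) (z - u * a).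
Proof.
move=> a0 z0 va; have za : vge v 0 (z / a).
  by right; rewrite dvalM ?invr_eq0 // dvalV // va; lia.
have [u [Ru hu]] := vge_residue _ za; exists u; split=> //.
have -> : z - u * a = a * (z / a - u) by rewrite mulrBr mulrCA divff // mulr1 mulrC.
by rewrite -va; apply: vgeM hu => //; right.
Qed.

(* Successive approximation of an element of [M] by elements of [N]: each step
   raises the value of the difference, until it reaches the region contained
   in [N]. *)
Lemma sub_of_values (M N : K -> Prop) (t B : int) :
  submod R M -> submod R N -> subsetK N M -> (forall z, vge v B z -> N z) ->
  (forall z, M z -> z != 0 -> t <= v z -> exists a, [/\ N a, a != 0 & v a = v z]) ->
  forall z, M z -> vge v t z -> N z.
Proof.
move=> sM sN NM NB hval z Mz zt.
suff main (k : nat) : forall z, M z -> vge v t z -> vge v (B - k%:Z) z -> N z.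
  by apply: (main `|B - v z|%N) => //; right; lia.
elim: k => [|k IH] {Mz zt}z Mz zt zk; first by apply: NB; rewrite subr0 in zk.
have [->|z0] := eqVneq z 0; first by case: sN.
have vt := vge_neq0 _ _ _ _ z0 zt; have vk := vge_neq0 _ _ _ _ z0 zk.
have [a [Na a0 va]] := hval _ Mz z0 vt.
have [u [Ru hu]] := approx _ _ a0 z0 va.
have Nua : N (u * a) by case: sN => _ _; apply.
rewrite -[z](subrK (u * a)); case: (sN) => _ ND _; apply: ND => //.
apply: IH; first by apply: (submodB _ _ hR) => //; apply: NM.
- by apply: vgeW hu; lia.
- by apply: vgeW hu; lia.
Qed.

Lemma vset_sub M N t : subsetK N M -> vset v N t -> vset v M t.
Proof. by move=> NM [a [/NM]]; exists a. Qed.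

(** * Elements of large value lie in [R] *)

Section Conductor.
Hypothesis hK : quotient_field_of R.
Hypothesis hfin : fin_gen R (integral_closure R).

Lemma common_denominator (g : seq K) :
  exists d, [/\ R d, d != 0 & forall i, (i < size g)%N -> R (d * g`_i)].
Proof.
case: (hR) => _ R1 _ RM; elim: g => [|z g [d [Rd d0 hd]]].
  by exists 1; split=> //; apply: oner_neq0.
have [a [b [Ra Rb b0 ->]]] := hK z.
exists (b * d); split; [exact: RM|exact: mulf_neq0|].
case=> [|i] /= ig; last by rewrite -mulrA; apply: RM => //; apply: hd.
have -> : b * d * (a / b) = d * a by field.
exact: RM.
Qed.

(** If [d] clears the denominators of generators of the integral closure, then [d] times the closure
    lies in [R], so [v d] is a bound. *)
Lemma exists_conductor : exists B, forall z, vge v B z -> R z.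
Proof.
have [g [gV gen]] := hfin; have [d [Rd d0 hd]] := common_denominator g.
have [_ RD RM] := subring_submod _ _ hR.
exists (v d) => z hz; have /hRbar/gen[cs [csR hcs]] : vge v 0 (z / d).
  by rewrite -(subrr (v d)); apply: vgeM => //; apply: vgeV.
rewrite -[z](divfK d0) hcs mulr_suml; apply: submod_sum (subring_submod _ _ hR) _ => i _.
by rewrite -mulrA; apply: RM => //; rewrite mulrC; apply: hd.
Qed.

Lemma conductor_sub (c : nat) : (forall m, (c <= m)%N -> vset v R m) ->
  forall z, vge v c%:Z z -> R z.
Proof.
move=> hc z hz; have [B hB] := exists_conductor.
(* The larger module is all of [K]: from [c] on, every value already occurs in [R]. *)
apply: (sub_of_values (fun _ => True) R c%:Z B) => // [|w _ w0 hw].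
  exact: subring_submod.
have [|a [Ra a0 va]] := hc `|v w|%N; first lia.
by exists a; split=> //; rewrite va; lia.
Qed.

End Conductor.

(** * Length as a number of values below [c] *)

Section Lengths.
Variable c : nat.

(** Such modules share all elements of value at least [c], so nested ones are told apart by their
    values below [c], which [vcnt] counts. *)
Definition between (M : K -> Prop) : Prop :=
  [/\ submod R M, forall z, vge v c%:Z z -> M z & subsetK M (vge v 0)].

Definition vcnt (M : K -> Prop) : nat := cnt (fun t => `[< vset v M t >]) c.

Lemma between_eq M N : between M -> between N -> subsetK N M ->
  (forall t, (t < c)%N -> vset v M t -> vset v N t) -> subsetK M N.
Proof.
move=> [sM MC M0] [sN NC N0] NM hval z Mz.
apply: (sub_of_values M N 0 c%:Z) => //; last exact: M0.
move=> w Mw w0 vw; have [wc|wc] := leqP c `|v w|%N.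
  by exists w; split=> //; apply: NC; right; lia.
case: (hval _ wc) => [|a [Na a0 va]]; last by exists a; split=> //; lia.
by exists w; split=> //; lia.
Qed.

Lemma leq_vcnt M N : subsetK N M -> (vcnt N <= vcnt M)%N.
Proof. by move=> NM; apply: leq_cnt => t _ /asboolP/(vset_sub _ _ _ NM)/asboolP. Qed.

Lemma ltn_vcnt M N : between M -> between N -> subsetK N M ->
  ~ subsetK M N -> (vcnt N < vcnt M)%N.
Proof.
move=> bM bN NM MN; have : ~ forall t, (t < c)%N -> vset v M t -> vset v N t.
  by move=> h; apply: MN; apply: between_eq h.
move=> /existsNP[t /not_implyP[tc /not_implyP[Mt Nt]]].
apply: (ltn_cnt _ _ t) => //; last first.
- exact/asboolP.
- exact/asboolP.
- by move=> i _ /asboolP/(vset_sub _ _ _ NM)/asboolP.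
Qed.

Lemma strict_chain_vcnt N M l ch : between N -> between M ->
  strict_chain R N M l ch -> (vcnt N + l <= vcnt M)%N.
Proof.
move=> bN bM hch; have sub := strict_chain_sub _ _ _ _ _ _ _ _ hch.
case: (hch) => h0 hl hs hst.
(* Every term of the chain inherits both bounds, so each strict inclusion gains a value below
   [c]. *)
have bch i : (i <= l)%N -> between (ch i).
  move=> il; split; first exact: hs.
  - case: bN => _ NC _ z /NC/h0; apply: sub; lia.
  - by case: bM => _ _ M0 z hz; apply/M0/hl/(sub i l); rewrite ?il /=.
have main i : (i <= l)%N -> (vcnt N + i <= vcnt (ch i))%N.
  elim: i => [|i IH] il; first by rewrite addn0; apply: leq_vcnt => z /h0.
  have [s1 [w [w1 w2]]] := hst _ il.
  rewrite addnS; apply: leq_ltn_trans (IH (ltnW il)) _.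
  by apply: ltn_vcnt; [exact: bch|exact/bch/ltnW|exact: s1|move/(_ _ w1)].
by apply: leq_trans (main _ (leqnn _)) _; apply: leq_vcnt => z /hl.
Qed.

(* With [t] the largest value of [M] that [N] misses, adding to [N] all
   elements of [M] of value at least [t] adds exactly the value [t]. *)
Lemma vcnt_step N M : between N -> between M -> subsetK N M -> ~ subsetK M N ->
  exists N', [/\ between N', subsetK N N', subsetK N' M & vcnt N' = (vcnt N).+1].
Proof.
move=> bN bM NM MN.
pose Q t := [&& (t < c)%N, `[< vset v M t >] & ~~ `[< vset v N t >]].
have exQ : exists t, Q t.
  apply/not_existsP => nQ; apply: MN; apply: between_eq => // t tc Mt.
  apply: contrapT => Nt; apply: (nQ t); apply/and3P; split=> //.
    exact/asboolP.
  exact/asboolPn.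
have Qc t : Q t -> (t <= c)%N by case/and3P => /ltnW.
case: (ex_maxnP exQ Qc) => t /and3P[tc /asboolP Mt /asboolPn Nt] tmax.
case: (bN) => sN NC N0; case: (bM) => sM MC M0.
have above z : M z -> vge v (t%:Z + 1) z -> N z.
  apply: (sub_of_values M N (t%:Z + 1) c%:Z) => // w Mw w0 vw.
  have [wc|wc] := leqP c `|v w|%N.
    by exists w; split=> //; apply: NC; right; lia.
  have : vset v N `|v w|%N.
    apply: contrapT => Nw; suff /tmax : Q `|v w|%N by lia.
    apply/and3P; split=> //; last exact/asboolPn.
    by apply/asboolP; exists w; split=> //; lia.
  by case=> a [Na a0 va]; exists a; split=> //; lia.
pose Mt' z := M z /\ vge v t%:Z z.
have sMt : submod R Mt'.
  case: sM => A0 AD AM; have [B0 BD BM] := vge_submod t%:Z; split.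
  - by split.
  - by move=> a b [? ?] [? ?]; split; [apply: AD|apply: BD].
  - by move=> a b ? [? ?]; split; [apply: AM|apply: BM].
have N'M : subsetK (addmod N Mt') M.
  by move=> _ [a [b [Na [Mb _] ->]]]; case: sM => _ AD _; apply: AD => //; apply: NM.
exists (addmod N Mt'); split=> //.
- split; first exact: addmod_submod.
  + by move=> z /NC Nz; apply: (addmod_l _ R) Nz.
  + by move=> z /N'M/M0.
- by move=> z Nz; apply: (addmod_l _ R) Nz.
rewrite -(cnt_predU1 _ t) //; last exact/asboolPn.
apply: eq_cnt => i _; apply/asboolP/orP; last first.
  case=> [/eqP->|/asboolP].
    case: Mt => a [Ma a0 va]; exists a; split=> //; apply: (addmod_r _ R) => //.
    by split=> //; right; lia.
  by apply: vset_sub => z Nz; apply: (addmod_l _ R) Nz.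
case=> _ [[a [b [Na [Mb hb] ->]]] ab0 vab].
have [/(above _ Mb) Nb|nb] := pselect (vge v (t%:Z + 1) b).
  by right; apply/asboolP; exists (a + b); split=> //; case: sN => _ ND _; apply: ND.
have b0 : b != 0 by apply/negP => /eqP b0; apply: nb; left.
have vb : v b = t%:Z.
  have hbt := vge_neq0 _ _ _ _ b0 hb.
  by apply/eqP; apply: contrapT => /negP ne; apply: nb; right; lia.
have [a0|a0] := eqVneq a 0.
  by left; apply/eqP; move: vab; rewrite a0 add0r; lia.
have vat : v a <> t%:Z by move=> va; apply: Nt; exists a.
(* As [v a] differs from [t = v b], the sum takes the smaller of the two: a value of [N], or [t]
   itself. *)
have [lt|le] := ltP (v a) (v b).
  have [|_ e] := dvalD_lt _ _ hv _ b a0; first by right; lia.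
  by right; apply/asboolP; exists a; split=> //; rewrite -e.
have [|_ e] := dvalD_lt _ _ hv _ a b0; first by right; lia.
by left; apply/eqP; move: vab; rewrite addrC e; lia.
Qed.

Lemma strict_chain_exists N M : between N -> between M -> subsetK N M ->
  exists ch, strict_chain R N M (vcnt M - vcnt N) ch.
Proof.
move=> bN bM NM; have [d hd] := ubnP (vcnt M - vcnt N).
elim: d N bN NM hd => // d IH N bN NM hd.
have [sN _ _] := bN.
have [MN|MN] := pselect (subsetK M N).
  have -> : (vcnt M - vcnt N = 0)%N by have := leq_vcnt _ _ MN; lia.
  by exists (fun _ => N); split=> // x; split; [apply: NM|apply: MN].
have [N' [bN' NN' N'M eN']] := vcnt_step _ _ bN bM NM MN.
have le := leq_vcnt _ _ N'M.
have [|ch hch] := IH N' bN' N'M; first lia.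
exists (fun i => if i is i'.+1 then ch i' else N).
have -> : (vcnt M - vcnt N = (vcnt M - vcnt N').+1)%N by lia.
apply: strict_chain_cons hch => //.
have : ~ subsetK N' N by move=> /leq_vcnt; lia.
by move=> /existsNP[w /not_implyP h]; exists w.
Qed.

(** A chain of length [l] has at most [vcnt M - vcnt N] steps, and [strict_chain_exists] attains
    this number, which maximality bounds by [l]. *)
Lemma length_vcnt N M l : between N -> between M -> subsetK N M ->
  length_is R M N l -> vcnt M = (vcnt N + l)%N.
Proof.
move=> bN bM NM [[ch hch] hmax]; have [ch' hch'] := strict_chain_exists _ _ bN bM NM.
by have := strict_chain_vcnt _ _ _ _ bN bM hch; have := hmax _ _ hch'; lia.
Qed.

End Lengths.

End Values.

Arguments between {K} R v c M.
Arguments vcnt {K} v c M.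

(** * The semigroup of values of [R] and its conductor *)

Section ValueSemigroup.
Variables (K : fieldType) (R : K -> Prop) (v : K -> int).
Hypothesis hR : subring R.
Hypothesis hv : discrete_valuation v.
Hypothesis hRbar : forall z, integral_closure R z <-> val_ring v z.
Hypothesis hres : residually_rational R v.
Variable c : nat.
Hypothesis c_gt0 : (0 < c)%N.
Hypothesis hcond : forall z, vge v c%:Z z -> R z.
Hypothesis hc1 : ~ vset v R c.-1.

Let R_vge0 := subring_vge0 _ _ _ hR hRbar.

Lemma vsetD a b : vset v R a -> vset v R b -> vset v R (a + b)%N.
Proof.
case: (hR) => _ _ _ RM [z [Rz z0 vz]] [w [Rw w0 vw]].
exists (z * w); split; [exact: RM|exact: mulf_neq0|].
by rewrite (dvalM _ _ hv) // vz vw.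
Qed.

Lemma vset0 : vset v R 0%N.
Proof. by case: hR => _ R1 _ _; exists 1; rewrite oner_neq0 (dval1 _ _ hv). Qed.

Lemma between_ring : between R v c R.
Proof. by split; [exact: subring_submod|exact: hcond|exact: R_vge0]. Qed.

Lemma between_closure : between R v c (integral_closure R).
Proof.
have [V0 VD VM] := vge_submod _ _ _ hR hv hRbar 0; split; [split|..].
- exact/hRbar.
- by move=> a b /hRbar ha /hRbar hb; apply/hRbar/VD.
- by move=> a b ha /hRbar hb; apply/hRbar/VM.
- by move=> z hz; apply/hRbar; apply: vgeW hz; lia.
- by move=> z /hRbar.
Qed.

Lemma vcnt_closure : vcnt v c (integral_closure R) = c.
Proof.
rewrite -[RHS]cnt_predT; apply: eq_cnt => t _; apply/asboolP.
have [a [a0 va]] := exists_val _ _ hv t%:Z.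
by exists a; split=> //; apply/hRbar; right; rewrite va.
Qed.

(* Otherwise a multiple of [z] by an element of value at least [t] would have
   value [c - 1]. *)
Lemma colon_vge (t : nat) z : (t <= c)%N -> colon R (vge v t%:Z) z ->
  vge v (c%:Z - t%:Z) z.
Proof.
move=> tc hz; have [->|z0] := eqVneq z 0; first by left.
right; apply: contrapT => /negP; rewrite -ltNge => vz; apply: hc1.
have [w [w0 vw]] := exists_val _ _ hv (c%:Z - 1 - v z).
exists (z * w); split; [apply: hz; right; lia|exact: mulf_neq0|].
by rewrite (dvalM _ _ hv) // vw; lia.
Qed.

Lemma between_colon I : subsetK I R -> (forall z, vge v c%:Z z -> I z) ->
  between R v c (colon R I).
Proof.
move=> IR CI; split; first exact: colon_submod.
  move=> z hz a /IR/R_vge0 ha; apply: hcond.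
  by rewrite -[c%:Z]addr0; apply: vgeM.
(* [colon_vge] is used at [t = c], where its bound [c - t] is 0. *)
move=> z hz; rewrite -(subrr c%:Z); apply: colon_vge => // a /CI; exact: hz.
Qed.

Lemma conductor_vge z : colon R (integral_closure R) z <-> vge v c%:Z z.
Proof.
split=> [hz|hz a /hRbar ha].
  by rewrite -[c%:Z]subr0; apply: (colon_vge 0%N) => // a ha; apply/hz/hRbar.
by apply: hcond; rewrite -[c%:Z]addr0; apply: vgeM.
Qed.

(** * Lower bounds on [r] *)

Section Multiplicity.
Variables (e r : nat).
Hypothesis e_gt0 : (0 < e)%N.
Hypothesis he : vset v R e.
Hypothesis e_min : forall t, vset v R t -> (0 < t)%N -> (e <= t)%N.
Hypothesis hr : length_is R (colon R (maxideal R)) R r.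

Let S : pred nat := fun t => `[< vset v R t >].

Lemma maxideal_vge a : maxideal R a -> vge v e%:Z a.
Proof.
move=> ma; have [->|a0] := eqVneq a 0; first by left.
have := vge_neq0 _ _ _ _ a0 (maxideal_val_gt0 _ _ _ hR hv hRbar _ ma) => va; right.
suff : (e <= `|v a|)%N by lia.
by apply: e_min; [exists a; split=> //; [case: ma|lia]|lia].
Qed.

Lemma chain_le_type M l ch : strict_chain R R M l ch ->
  subsetK M (colon R (maxideal R)) -> (l <= r)%N.
Proof.
move=> hch hM.
have [m [ch' [lm /(proj2 hr)]]] :=
  strict_chain_extend _ _ _ _ _ _ _ hch (colon_submod _ _ hR _) hM.
exact: leq_trans.
Qed.

(** The maximal ideal has values at least [e], so it sends [M] into [R]; hence [r] bounds the number
    of values that [M] adds to [R], and [M] has all [e] values from [c - e] to [c - 1]. *)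
Lemma cnt_top : (e <= c)%N ->
  (cnt S (c - e) + e <= cnt S c + r)%N /\ (0 < r)%N.
Proof.
move=> ec; pose M := addmod R (vge v (c%:Z - e%:Z)).
have sV := vge_submod _ _ _ hR hv hRbar (c%:Z - e%:Z).
have sR := subring_submod _ _ hR.
have bM : between R v c M.
  split; first exact: addmod_submod.
  - by move=> z /hcond Rz; apply: (addmod_l _ R) Rz.
  - move=> _ [a [b [Ra hb ->]]]; apply: (vgeD _ _ hv); first exact: R_vge0.
    by apply: vgeW hb; lia.
have RM : subsetK R M by move=> z Rz; apply: (addmod_l _ R) Rz.
have [ch hch] := strict_chain_exists _ _ _ hR hv hRbar hres _ _ _ between_ring bM RM.
have ler : (vcnt v c M - vcnt v c R <= r)%N.
  apply: chain_le_type hch _ => _ [a [b [Ra hb ->]]] z mz.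
  have [Rz _] := mz; case: sR => _ RD RZ; rewrite mulrDl; apply: RD; first exact: RZ.
  apply: hcond; rewrite -[c%:Z](subrK e%:Z); apply: vgeM => //; exact: maxideal_vge.
have Mtop t : (c - e <= t)%N -> vset v M t.
  move=> ht; have [a [a0 va]] := exists_val _ _ hv t%:Z.
  by exists a; split=> //; apply: (addmod_r _ R) => //; right; lia.
(* The value [c - 1] is taken on [M] but not on [R], which makes [r] positive. *)
have lt : (vcnt v c R < vcnt v c M)%N.
  apply: (ltn_cnt _ _ c.-1) => [i _ /asboolP h|||].
  - by apply/asboolP; apply: vset_sub h.
  - by rewrite prednK.
  - by apply/asboolP/Mtop; lia.
  - exact/asboolPn.
split; last lia.
suff : (cnt S (c - e) + e <= vcnt v c M)%N by rewrite /vcnt -/S in lt ler *; lia.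
rewrite /vcnt (cnt_full _ (c - e) c (leq_subr _ _)); last first.
  by move=> t /andP[/Mtop h _]; apply/asboolP.
have -> : (c - (c - e) = e)%N by lia.
by rewrite leq_add2r; apply: leq_cnt => t _ /asboolP h; apply/asboolP; apply: vset_sub h.
Qed.

(** * The ideal generated by the conductor and [x] *)

Section MinimalReduction.
Variable x : K.
Hypothesis hx : R x.
Hypothesis x0 : x != 0.
Hypothesis vx : v x = e%:Z.

Lemma condxR_sub : subsetK (condxR R x) R.
Proof.
have [_ RD RM] := subring_submod _ _ hR.
move=> _ [y [a [/conductor_vge/hcond Ry Ra ->]]]; apply: RD => //; exact: RM.
Qed.

Lemma between_condxR : between R v c (condxR R x).
Proof.
have sR := subring_submod _ _ hR; have [R0 RD RM] := sR.
have [C0 CD CM] := colon_submod _ _ hR (integral_closure R).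
split; last by move=> z /condxR_sub/R_vge0.
  split; first by exists 0, 0; rewrite mulr0 addr0.
  - move=> _ _ [y [a [Cy Ra ->]]] [y' [a' [Cy' Ra' ->]]].
    by exists (y + y'), (a + a'); split; [exact: CD|exact: RD|rewrite mulrDr addrACA].
  - move=> u _ Ru [y [a [Cy Ra ->]]].
    by exists (u * y), (u * a); split; [exact: CM|exact: RM|rewrite mulrDr mulrCA].
by move=> z /conductor_vge Cz; exists z, 0; rewrite mulr0 addr0.
Qed.

(** A conductor summand has value at least [c], so below [c] only the values of [x * a] appear,
    which are those of [R] shifted by [e]. *)
Lemma vset_condxR t : (t < c)%N -> `[< vset v (condxR R x) t >] = (e <= t)%N && S (t - e)%N.
Proof.
move=> tc; apply/asboolP/andP.
  case=> _ [[y [a [/conductor_vge hy Ra ->]]] z0 vz].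
  have [] := dvalD_lt _ _ hv (y + x * a) (- y) z0.
    by apply/(vgeN _ _ hv)/(vgeW _ _ _ _ _ _ hy); lia.
  rewrite addrAC subrr add0r mulf_eq0 negb_or => /andP[_ a0].
  rewrite vz (dvalM _ _ hv) // vx => va.
  have va0 := vge_neq0 _ _ _ _ a0 (R_vge0 _ Ra).
  by split; [lia|apply/asboolP; exists a; split=> //; lia].
case=> et /asboolP[a [Ra a0 va]]; exists (x * a); split; last 2 first.
- exact: mulf_neq0.
- by rewrite (dvalM _ _ hv) // vx va; lia.
- by exists 0, a; rewrite add0r; split=> //; apply/conductor_vge; left.
Qed.

Lemma length_condxR k : length_is R R (condxR R x) k -> cnt S c = (cnt S (c - e) + k)%N.
Proof.
move/(length_vcnt _ _ _ hR hv hRbar hres c _ _ _ between_condxR between_ring condxR_sub).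
by rewrite -cnt_shift -(eq_cnt _ _ _ vset_condxR).
Qed.

Lemma cnt_progressions k p (y l : nat -> nat) :
  (p * e < c)%N -> (c <= p.+1 * e)%N ->
  (forall i j, (1 <= i)%N -> (i < j)%N -> (j <= k.-1)%N -> (y i < y j)%N) ->
  (forall t, [/\ (0 < t)%N, vset v R t & ~ vset v (condxR R x) t] <->
             exists i, (1 <= i <= k.-1)%N /\ y i = t) ->
  (forall i, (1 <= i <= k.-1)%N ->
             (y i + l i * e < c)%N /\ (c <= y i + (l i).+1 * e)%N) ->
  cnt S c = (p.+1 + \sum_(1 <= i < k) (l i).+1)%N.
Proof.
move=> p1 p2 ymono hy hl.
have S_add t : S t -> S (t + e)%N by move=> /asboolP h; apply/asboolP/vsetD.
pose F w := (\sum_(0 <= j < c) (w + j * e < c))%N.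
rewrite (cnt_sum_apery _ _ e_gt0 S_add) -/(F _) -big_filter.
(* By [vset_condxR], being an Apery element below [c] means being a value of [R] but not of
   [condxR R x]: these are 0 and the [y i]. *)
have : perm_eq [seq w <- index_iota 0 c | apery S e w] (0%N :: [seq y i | i <- index_iota 1 k]).
  apply: uniq_perm.
  - by rewrite filter_uniq // iota_uniq.
  - rewrite /= map_inj_in_uniq ?iota_uniq ?andbT.
      apply/mapP => -[i]; rewrite mem_index_iota => ik y0.
      have /hy[] : exists j, (1 <= j <= k.-1)%N /\ y j = y i by exists i; split=> //; lia.
      by rewrite -y0.
    move=> i j; rewrite !mem_index_iota => ik jk yij.
    have [ij|ij|//] := ltngtP i j.
      by have := ymono i j; rewrite yij ltnn => /(_ _ ij); lia.
    by have := ymono j i; rewrite yij ltnn => /(_ _ ij); lia.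
  move=> t; rewrite mem_filter mem_index_iota inE; apply/andP/orP.
    case=> /andP[/asboolP St nt] /= tc; have [->|t0] := eqVneq t 0%N; [by left|right].
    have /hy[i [ik <-]] : [/\ (0 < t)%N, vset v R t & ~ vset v (condxR R x) t].
      by split=> //; [lia|apply/asboolPn; rewrite vset_condxR].
    by apply: map_f; rewrite mem_index_iota; lia.
  case=> [/eqP->|/mapP[i]].
    rewrite /apery; split; last by rewrite leq0n.
    apply/andP; split; first exact/asboolP/vset0.
    by rewrite leqNgt e_gt0.
  rewrite mem_index_iota => ik ->.
  have ik' : (1 <= i <= k.-1)%N by lia.
  have /hy[yi0 Sy nSy] : exists j, (1 <= j <= k.-1)%N /\ y j = y i by exists i.
  have [yc _] := hl _ ik'.
  have yc' : (y i < c)%N by lia.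
  split=> //; apply/andP; split; first exact/asboolP.
  by rewrite -vset_condxR //; apply/asboolPn.
move=> /(perm_big _) ->; rewrite big_cons big_map; congr addn.
  exact: progression_count.
apply: eq_big_nat => i ik; have [|h1 h2] := hl i; first lia.
exact: progression_count.
Qed.

End MinimalReduction.

(** * The filtration [R_i] and the colon modules [(R : R_i)] *)

Section Filtration.
Variables (s r_ : nat -> nat) (n : nat).
Hypothesis s0 : s 0%N = 0%N.
Hypothesis s_incr : forall i, (s i < s i.+1)%N.
Hypothesis s_enum : forall t, vset v R t <-> exists i, s i = t.
Hypothesis sn : s n = c.
Hypothesis hri : forall i, (1 <= i <= n)%N ->
  length_is R (colon R (Rfilt R v s i)) (colon R (Rfilt R v s i.-1)) (r_ i).

Let s_mono : {mono s : i j / (i <= j)%N}.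
Proof. by apply/leq_mono; apply: homo_ltn s_incr; apply: ltn_trans. Qed.

Lemma Rfilt_sub i j : (i <= j)%N -> subsetK (Rfilt R v s j) (Rfilt R v s i).
Proof.
move=> ij z [Rz hz]; split=> //; apply: vgeW hz.
by rewrite lez_nat s_mono.
Qed.

Lemma colon_Rfilt_sub i j : (i <= j)%N ->
  subsetK (colon R (Rfilt R v s i)) (colon R (Rfilt R v s j)).
Proof. by move=> ij z hz a /(Rfilt_sub _ _ ij); apply: hz. Qed.

Lemma between_colon_Rfilt i : (i <= n)%N -> between R v c (colon R (Rfilt R v s i)).
Proof.
move=> hin; apply: between_colon => [z []//|z hz]; split; first exact: hcond.
by apply: vgeW hz; rewrite lez_nat -sn s_mono.
Qed.

(** The lengths [r_ i] add up along the tower of the [(R : R_i)], which starts at [(R : R_0) = R]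
    because [s 0 = 0]. *)
Lemma vcnt_colon_Rfilt j : (j <= n)%N ->
  vcnt v c (colon R (Rfilt R v s j)) = (cnt S c + \sum_(1 <= i < j.+1) r_ i)%N.
Proof.
elim: j => [|j IH] jn.
  rewrite big_geq // addn0; apply: eq_cnt => t _.
  apply/asboolP/asboolP; apply: vset_sub => z.
    move=> /(_ 1); rewrite mulr1; apply; split; first by case: hR.
    by rewrite s0 (dval1 _ _ hv); right.
  by move=> Rz a [Ra _]; case: hR => _ _ _; apply.
rewrite big_nat_recr //= addnA -IH; last exact: ltnW.
apply: (length_vcnt _ _ _ hR hv hRbar hres).
- exact/between_colon_Rfilt/ltnW.
- exact: between_colon_Rfilt.
- exact: colon_Rfilt_sub.
- exact: hri.
Qed.

Lemma vcnt_colon_top i : (e <= c)%N -> (c <= s i + e)%N ->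
  (c - e < vcnt v c (colon R (Rfilt R v s i)))%N.
Proof.
move=> ec ci; rewrite /vcnt.
pose P t := (t == 0%N) || (e <= t)%N.
(* The value 0 together with [e], ..., [c - 1] makes [c - e + 1] values. *)
have -> : (c - e).+1 = cnt P c.
  rewrite cnt_predU1 // -?ltnNge // -[in LHS](cnt_predT (c - e)) -cnt_shift.
  by congr (_.+1); apply: eq_cnt => t _; rewrite andbT.
apply: leq_cnt => t _ /orP[/eqP->|et]; apply/asboolP.
  apply: vset_sub vset0 => z Rz a [Ra _]; case: hR => _ _ _; exact.
(* Times an element of [R_i], the value becomes at least [e + s i >= c], so the product lies in
   [R]. *)
have [a [a0 va]] := exists_val _ _ hv t%:Z.
exists a; split=> // w [Rw hw]; apply: hcond.
have : vge v (t%:Z + (s i)%:Z) (a * w) by apply: vgeM => //; right; rewrite va.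
by apply: vgeW; lia.
Qed.

(* Multiplication by an element of value [s i] embeds
   (R : R_(i+1)) / (R : R_i) into (R : m) / R. *)
Lemma colon_Rfilt_length_le i : (i < n)%N -> (r_ i.+1 <= r)%N.
Proof.
move=> hin; have [|[ch hch] _] := hri i.+1; first lia.
have [z [Rz z0 vz]] : vset v R (s i) by apply/s_enum; exists i.
have sub := strict_chain_sub _ _ _ _ _ _ _ _ hch.
have sR := subring_submod _ _ hR; have [R0 RD RM] := sR.
case: (hch) => /= h0 hl hs hst.
have next w : R w -> vge v ((s i)%:Z + 1) w -> Rfilt R v s i.+1 w.
  move=> Rw hw; split=> //; have [->|w0] := eqVneq w 0; [by left|right].
  have vw := vge_neq0 _ _ _ _ w0 hw.
  have /s_enum[j sj] : vset v R `|v w|%N by exists w; split=> //; lia.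
  have ij : (i < j)%N by rewrite ltnNge -s_mono; lia.
  by move: ij; rewrite -s_mono sj; lia.
have zlow w : colon R (Rfilt R v s i) w -> R (z * w).
  by move=> hw; rewrite mulrC; apply: hw; split=> //; right; rewrite vz.
(* Injectivity of the embedding: an element of [R_i] is a multiple of [z] up to an element of
   [R_(i+1)]. *)
have zcol w : colon R (Rfilt R v s i.+1) w -> R (z * w) -> colon R (Rfilt R v s i) w.
  move=> hw Rzw a [Ra ha]; have [->|a0] := eqVneq a 0; first by rewrite mulr0.
  have va := vge_neq0 _ _ _ _ a0 ha.
  have [ai|ai] := eqVneq (v a) (s i)%:Z; last first.
    by apply/hw/next => //; right; lia.
  have va' : v z = v a by rewrite vz.
  have [u [Ru hu]] := approx _ _ _ hv hRbar hres z a z0 a0 va'.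
  have -> : w * a = w * (a - u * z) + u * (z * w) by ring.
  apply: RD; last exact: RM.
  apply/hw/next; last by rewrite -ai.
  by apply: (submodB _ _ hR) => //; apply: RM.
apply: (chain_le_type (addmod R (scalemod z (ch (r_ i.+1)))) _
   (fun j => addmod R (scalemod z (ch j)))).
  split=> //.
  - move=> w; split=> [[a [_ [Ra [b /h0/zlow Rzb ->] ->]]]|Rw]; first exact: RD.
    by apply: (addmod_l _ R) Rw; apply: scalemod_submod; apply: hs.
  - by move=> j jr; apply: addmod_submod => //; apply: scalemod_submod; apply: hs.
  - move=> j jr; have [s1 [w [w1 w2]]] := hst _ jr; split.
      by move=> _ [a [_ [Ra [b /s1 hb ->] ->]]]; exists a, (z * b); split=> //; exists b.
    exists (z * w); split; first by apply: (addmod_r _ R) => //; exists w.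
    (* Here [z * (w - b) = a] lies in [R], so [zcol] puts [w - b] in the bottom term and [w] would
       lie in [ch j]. *)
    case=> a [_ [Ra [b hb ->] e1]]; apply: w2.
    have sj := hs _ jr; have sj' := hs _ (ltnW jr).
    rewrite -[w](subrK b); case: (sj') => _ chD _; apply: chD => //.
    apply: (sub 0%N); first by rewrite (ltnW jr).
    apply/h0/zcol.
      apply/hl/(sub j.+1); first by rewrite jr leqnn.
      by apply: (submodB _ _ hR) => //; apply: s1.
    by rewrite mulrBr e1 addrK.
(* For [w] in the maximal ideal, [z * w] has value above [s i], so it lies in [R_(i+1)] and [b]
   sends it into [R]. *)
move=> _ [a [_ [Ra [b /hl hb ->] ->]]] w mw; have [Rw _] := mw.
rewrite mulrDl; apply: RD; first exact: RM.
have -> : z * b * w = b * (z * w) by ring.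
apply/hb/next; first exact: RM.
rewrite -vz; apply: vgeM => //; first by right.
exact: (maxideal_val_gt0 _ _ _ hR hv hRbar).
Qed.

End Filtration.

End Multiplicity.

End ValueSemigroup.

(** * Combining the counts for [n], [k] and [i0] into the identities and inequalities *)

Theorem theorem2p2 (K : fieldType) (R : K -> Prop) (v : K -> int)
  (hR : subring R) (hK : quotient_field_of R) (hnoeth : noetherian R)
  (hloc : local R) (hdim : dim_one R) (hnreg : ~ regular R)
  (hv : discrete_valuation v)
  (hRbar : forall z, integral_closure R z <-> val_ring v z)
  (hfin : fin_gen R (integral_closure R))
  (hres : residually_rational R v)
  (c delta r e n i0 k p : nat) (s r_ y l : nat -> nat) (x : K)
  (hc : [/\ vset v R c, (forall m, (c <= m)%N -> vset v R m)
          & forall c', vset v R c' -> (forall m, (c' <= m)%N -> vset v R m) ->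
                       (c <= c')%N])
  (hdelta : length_is R (integral_closure R) R delta)
  (hr : length_is R (colon R (maxideal R)) R r)
  (he : [/\ vset v R e, (0 < e)%N & forall t, vset v R t -> (0 < t)%N -> (e <= t)%N])
  (hn : n%:Z = c%:Z - delta%:Z)
  (hs : [/\ s 0%N = 0%N, (forall i, (s i < s i.+1)%N)
          & forall t, vset v R t <-> exists i, s i = t])
  (hri : forall i, (1 <= i <= n)%N ->
           length_is R (colon R (Rfilt R v s i)) (colon R (Rfilt R v s i.-1)) (r_ i))
  (hi0 : [/\ (1 <= i0 <= n)%N, vset v R (s i0.-1), c%:Z - e%:Z <= (s i0.-1)%:Z
          & forall t, vset v R t -> c%:Z - e%:Z <= t%:Z -> (s i0.-1 <= t)%N])
  (hx : [/\ maxideal R x, x != 0 & v x = e%:Z])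
  (hk : length_is R R (condxR R x) k)
  (hk1 : (1 < k)%N)
  (hp : c%:Z - e%:Z <= (p * e)%:Z /\ (p * e < c)%N)
  (hy : (forall i j, (1 <= i)%N -> (i < j)%N -> (j <= k.-1)%N -> (y i < y j)%N) /\
        (forall t, [/\ (0 < t)%N, vset v R t & ~ vset v (condxR R x) t] <->
                   exists i, (1 <= i <= k.-1)%N /\ y i = t))
  (hl : forall i, (1 <= i <= k.-1)%N ->
          (y i + l i * e < c)%N /\ (c <= y i + (l i).+1 * e)%N) :
  let b : int := (c%:Z - delta%:Z) * r%:Z - delta%:Z in
  let h : int := ((p + 1) * e)%:Z - c%:Z in
  let X : int := (k%:Z - 1) * (r%:Z - 1) in
  let Y : int := k%:Z - (e%:Z - r%:Z) in
  let Z : int := (r%:Z + 1) * (p%:Z + \sum_(1 <= i < k) (l i)%:Z)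
                 + k%:Z + h - (p * e)%:Z - 1 in
  let sA : int := \sum_(1 <= i < i0) (r%:Z - (r_ i)%:Z) in
  [/\ b = (r%:Z + 1) * (\sum_(1 <= i < k) ((l i)%:Z + 1))
          - (p%:Z + 1) * (e%:Z - r%:Z - 1) + h,
      b = X + Y + Z,
      0 <= X /\ 0 <= Y,
      sA <= Z /\ 0 <= sA
    & c%:Z = (p%:Z + 1 + \sum_(1 <= i < k) ((l i)%:Z + 1)) * (r%:Z + 1) - b].
Proof.
have [c_in c_up c_min] := hc; have [e_in e_gt0 e_min] := he.
have [s0 s_incr s_enum] := hs; have [[Rx _] x0 vx] := hx.
have [hp1 hp2] := hp; have [ymono yset] := hy.
have [i0n _ si0 si0_min] := hi0.
have c_gt0 : (0 < c)%N by lia.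
have ec : (e <= c)%N by apply: e_min.
have hc1 : ~ vset v R c.-1.
  move=> h; suff : (c <= c.-1)%N by lia.
  apply: c_min => // m; have [/c_up //|mc cm] := leqP c m.
  by have -> : m = c.-1 by lia.
have hcond := conductor_sub _ _ _ hR hv hRbar hres hK hfin c c_up.
pose S : pred nat := fun t => `[< vset v R t >].
(* The closure has all [c] values below [c], so [delta] is [c] minus the number of those of [R]. *)
have cntS : cnt S c = n.
  have bR := between_ring _ _ _ hR hRbar _ hcond.
  have bV := between_closure _ _ _ hR hv hRbar _ c_gt0.
  have RV : subsetK R (integral_closure R).
    by move=> z /(subring_vge0 _ _ _ hR hRbar)/hRbar.
  have := length_vcnt _ _ _ hR hv hRbar hres c _ _ _ bR bV RV hdelta.
  by rewrite (vcnt_closure _ _ _ hv hRbar) /vcnt -/S; lia.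
have cnt_s : forall j, cnt S (s j) = j.
  by apply: cnt_enum => // t; rewrite -s_enum; split=> /asboolP.
have sn : s n = c.
  by have /s_enum[j sj] := c_in; rewrite -cntS -sj cnt_s.
(* [s i0.-1] is the first value at or above [c - e], and its index counts the smaller ones. *)
have cnt_ce : cnt S (c - e) = i0.-1.
  rewrite -(cnt_s i0.-1); apply/esym/cnt_gap; first lia.
  move=> t /andP[t1 t2]; apply/asboolPn => ht.
  by have := si0_min _ ht; lia.
have [rk r_gt0] := cnt_top _ _ _ hR hv hRbar hres _ c_gt0 hcond hc1 _ _ e_gt0 e_min hr ec.
have ek := length_condxR _ _ _ hR hv hRbar hres _ c_gt0 hcond hc1 _ e_gt0 _ Rx x0 vx _ hk.
have c_le : (c <= p.+1 * e)%N by lia.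
have np := cnt_progressions _ _ _ hR hv hRbar _ c_gt0 hcond hc1 _ e_gt0 e_in _ x0 vx
  _ _ _ _ hp2 c_le ymono yset hl.
have ri_le i : (1 <= i < i0)%N -> (r_ i <= r)%N.
  case: i => // i i_lt.
  apply: (colon_Rfilt_length_le _ _ _ hR hv hRbar hres _ c_gt0 _ _ e_gt0 hr _ _ n s0 s_incr) => //.
  lia.
(* Two counts for [(R : R_(i0-1))] are compared, giving [hA]: [c - e] is less than [n] plus the sum
   of [r_ i] over [A]. *)
have := vcnt_colon_top _ _ _ hR hv _ c_gt0 hcond _ e_gt0 _ _ s0 sn i0.-1 ec.
rewrite (vcnt_colon_Rfilt _ _ _ hR hv hRbar hres _ c_gt0 hcond hc1 _ _ _
  s0 s_incr sn hri); last lia.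
rewrite prednK; last lia.
move: rk ek np; rewrite -/S cntS cnt_ce => rk ek np.
have ci : (c <= s i0.-1 + e)%N by lia.
move=> /(_ ci) hA.
move=> b h X Y Z sA.
have sumZ a m (F : nat -> nat) : \sum_(a <= i < m) (F i)%:Z = (\sum_(a <= i < m) F i)%N%:Z.
  by rewrite (big_morph Posz PoszD erefl).
have sumlS : \sum_(1 <= i < k) ((l i)%:Z + 1) = (\sum_(1 <= i < k) (l i).+1)%N%:Z.
  by rewrite -sumZ; apply: eq_bigr => i _; rewrite -addn1 PoszD.
have sumSl : (\sum_(1 <= i < k) (l i).+1 = \sum_(1 <= i < k) l i + k.-1)%N.
  rewrite -[k.-1]subn1 -[(k - 1)%N]muln1 -sum_nat_const_nat -big_split /=.
  by apply: eq_bigr => i _; rewrite addn1.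
have sAE : sA = (i0.-1)%:Z * r%:Z - (\sum_(1 <= i < i0) r_ i)%N%:Z.
  by rewrite /sA sumrB sumr_const_nat sumZ -mulr_natl subn1 natz.
have sA_ge0 : 0 <= sA.
  rewrite /sA big_nat_cond; apply: sumr_ge0 => i; rewrite andbT => /ri_le; lia.
(* The progression count reads [n = p + k] plus the sum of the [l i]. *)
have ZE : Z = (r%:Z + 1) * n%:Z - c%:Z - X - Y.
  by rewrite /Z /X /Y /h sumZ np sumSl; lia.
rewrite sumlS /b.
split.
(* Since [delta = c - n], [b] equals [(r + 1) * n - c]. *)
- by rewrite /h -hn; nia.
- by rewrite ZE -hn; nia.
- by split; [rewrite /X; nia|rewrite /Y; lia].
(* With [n = i0 - 1 + k], [Z] becomes [(i0 - 1) * r + n - c + e - 1], so [sA <= Z] is exactly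
   [hA]. *)
- split=> //; rewrite sAE ZE /X /Y; nia.
- by rewrite -hn; nia.
Qed.
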